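(* Let $0<q<1$, let $\theta$ be real, $z>0$, and $u=e^{i\theta}z(1-q^2)$. For $j=1,2,3$ put $\Lambda^{(j)}(u)=e_q^{(j)}(u)\,e_q^{(j)}\!\left(\frac qu\right)$, and let $\delta=2,0,1$ for $j=1,2,3$ respectively. Then $\Lambda^{(j)}(u)$ can be represented as the Laurent series $$\Lambda^{(j)}(u)=\sum_{l=-\infty}^\infty u^l\,q^{\frac{2-\delta}4l^2-\frac l2}\,I_l^{(j)}(2q^{\frac\delta4};q),$$ where for $j=1$ it is required that $q<|u|<1$.
   Context: Notation: $(a,q)_n=(1-a)(1-aq)\cdots(1-aq^{n-1})$, $(a,q)_\infty=\lim_{n\to\infty}(a,q)_n$, $\Gamma_q(\alpha)=\frac{(q,q)_\infty}{(q^\alpha,q)_\infty}(1-q)^{1-\alpha}$. The $q$-exponentials are $$e_q^{(1)}(u)=\frac1{(u,q)_\infty}=\sum_{n\ge0}\frac{u^n}{(q,q)_n}\ (|u|<1),\qquad e_q^{(2)}(u)=(-u,q)_\infty=\sum_{n\ge0}\frac{q^{n(n-1)/2}u^n}{(q,q)_n},\qquad e_q^{(3)}(u)=\sum_{n\ge0}\frac{q^{n(n-1)/4}u^n}{(q,q)_n}.$$ The modified $q^2$-Bessel functions are $$I_\nu^{(j)}(2(1-q^2)z;q^2)=\frac1{\Gamma_{q^2}(\nu+1)}\sum_{n=0}^\infty\frac{q^{(2-\delta)n(n+\nu)}(1-q^2)^{2n}z^{\nu+2n}}{(q^2,q^2)_n(q^{2\nu+2},q^2)_n},$$ and $I_\nu^{(j)}(\cdot\,;q)$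 is obtained by replacing $q^2$ by $q$ everywhere; explicitly, for an integer $l\ge0$, $$I_l^{(j)}(2x;q)=\frac1{(q,q)_l}\sum_{n=0}^\infty\frac{q^{\frac{2-\delta}2n(n+l)}x^{l+2n}}{(q,q)_n(q^{l+1},q)_n},$$ and $I_{-l}^{(j)}(2x;q)=I_l^{(j)}(2x;q)$ (for $j=1$, $|x|<1$). *)

(* Defs.v *)
(* Stdlib reals, with Coquelicot for complex numbers, limits and series. *)
From Stdlib Require Import Reals ZArith.
From Coquelicot Require Import Coquelicot.
Open Scope R_scope.

(* [Clim] and [CSeries] take the real and imaginary parts separately, with
   Coquelicot's total [Lim_seq] and [Series]; the two lemmas below say that
   they agree with convergence in C. *)
Definition Clim (a : nat -> C) : C :=
  (real (Lim_seq (fun n => Re (a n))), real (Lim_seq (fun n => Im (a n)))).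

Definition CSeries (a : nat -> C) : C :=
  (Series (fun n => Re (a n)), Series (fun n => Im (a n))).

Lemma filterlim_Re_Im (a : nat -> C) (l : C) :
  filterlim a eventually (locally l) ->
  is_lim_seq (fun n => Re (a n)) (Re l) /\ is_lim_seq (fun n => Im (a n)) (Im l).
Proof.
  intros H; split; intros P [e He].
  - apply (H (fun z : C => P (Re z))); exists e; intros y [H1 H2]; now apply He.
  - apply (H (fun z : C => P (Im z))); exists e; intros y [H1 H2]; now apply He.
Qed.

Lemma Clim_correct (a : nat -> C) (l : C) :
  filterlim a eventually (locally l) -> Clim a = l.
Proof.
  intros H; destruct (filterlim_Re_Im a l H) as [H1 H2].
  unfold Clim; rewrite (is_lim_seq_unique _ _ H1), (is_lim_seq_unique _ _ H2).
  destruct l; reflexivity.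
Qed.

Lemma sum_n_Re_Im (a : nat -> C) (n : nat) :
  sum_n a n = (sum_n (fun k => Re (a k)) n, sum_n (fun k => Im (a k)) n).
Proof.
  induction n as [|n IH].
  - rewrite !sum_O; destruct (a 0%nat); reflexivity.
  - rewrite !sum_Sn, IH; reflexivity.
Qed.

Lemma CSeries_correct (a : nat -> C) (l : C) :
  is_series a l -> CSeries a = l.
Proof.
  intros H; destruct (filterlim_Re_Im _ l H) as [H1 H2].
  unfold CSeries; rewrite (is_series_unique _ (Re l)), (is_series_unique _ (Im l)).
  - destruct l; reflexivity.
  - apply (is_lim_seq_ext _ _ (Finite (Im l))) with (2 := H2).
    intros n; rewrite sum_n_Re_Im; reflexivity.
  - apply (is_lim_seq_ext _ _ (Finite (Re l))) with (2 := H1).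
    intros n; rewrite sum_n_Re_Im; reflexivity.
Qed.

Definition Cpowz (u : C) (l : Z) : C :=
  match l with
  | Z0 => 1%C
  | Zpos p => (u ^ Pos.to_nat p)%C
  | Zneg p => (/ (u ^ Pos.to_nat p))%C
  end.

(* A bilateral series converges when both of its one-sided parts do. *)
Definition is_bilateral_series (a : Z -> C) (s : C) : Prop :=
  exists s1 s2 : C,
    is_series (fun n : nat => a (Z.of_nat n)) s1 /\
    is_series (fun n : nat => a (- Z.of_nat (S n))%Z) s2 /\
    s = (s1 + s2)%C.

(* (a, q)_n *)
Fixpoint qpoch (a : C) (q : R) (n : nat) : C :=
  match n with
  | O => 1%C
  | S m => (qpoch a q m * (1 - a * RtoC q ^ m))%C
  end.

(* (a, q)_oo *)
Definition qpoch_inf (a : C) (q : R) : C := Clim (qpoch a q).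

(* The superscript (j), j = 1, 2, 3. *)
Inductive kind : Set := kind1 | kind2 | kind3.

Definition delta (j : kind) : R :=
  match j with kind1 => 2 | kind2 => 0 | kind3 => 1 end.

Definition qexp (j : kind) (q : R) (u : C) : C :=
  match j with
  | kind1 => (/ qpoch_inf u q)%C
  | kind2 => qpoch_inf (- u)%C q
  | kind3 =>
      CSeries (fun n : nat =>
        (RtoC (Rpower q (INR n * (INR n - 1) / 4)) * u ^ n / qpoch q q n)%C)
  end.

(* I_l^{(j)}(y; q) for an integer l; the defining series is written in terms
   of x = y / 2, and I_{-l}^{(j)} = I_l^{(j)}. *)
Definition qBesselI (j : kind) (q : R) (l : Z) (y : C) : C :=
  let m := Z.abs_nat l in
  let x := (y / 2)%C in
  (/ qpoch q q m *
   CSeries (fun n : nat =>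
     RtoC (Rpower q ((2 - delta j) / 2 * (INR n * (INR n + INR m))))
     * x ^ (m + 2 * n) / (qpoch q q n * qpoch (RtoC q ^ (m + 1)) q n)))%C.

Definition Lambda (j : kind) (q : R) (u : C) : C :=
  (qexp j q u * qexp j q (RtoC q / u))%C.

(* Main.v *)
(* With [kappa = (2 - delta) / 4], all three q-exponentials are sums of
   [c_n u^n], [c_n = q^(kappa n (n - 1)) / (q, q)_n].  For [j = 3] this is the
   definition.  For [j = 1, 2] the sum [f] satisfies
   [f(u) - f(q u) = u f(q^(2 kappa) u)]; iterating it relates [f(u)] to
   [f(q^n u)] through a q-Pochhammer symbol, and [f(q^n u)] tends to [1], which
   gives Euler's product formulas and the convergence of the products at once.

   Multiplying the series at [u] and at [q / u] and collecting the terms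
   [c_(n+p) c_(n+r) u^(p-r) q^(n+r)] with [l = p - r] fixed gives the Bessel
   series.  The rearrangement avoids a general Fubini theorem: if [A_n], [B_n]
   are the tails of [sum a_n] and [sum b_n], the diagonals [l >= 0] add up to
   [sum A_n b_n], the diagonals [l < 0] to [sum a_n B_(n+1)], and
   [A_n b_n + a_n B_(n+1) = A_n B_n - A_(n+1) B_(n+1)] telescopes to
   [A_0 B_0]. *)
Require Import Defs.
From Stdlib Require Import Reals ZArith Lra Lia.
From Coquelicot Require Import Coquelicot.
Open Scope R_scope.

(* Coquelicot's series lemmas leave [plus], [opp] and the carrier as structure
   projections, which [ring] does not recognize. *)
Ltac C_ring :=
  change plus with Cplus; change opp with Copp;
  match goal with |- @eq _ ?x ?y => change (@eq C x y) end; ring.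

(** * Absolutely convergent complex series *)

Lemma RtoC_neq_0 (r : R) : r <> 0 -> RtoC r <> 0%C.
Proof. intros Hr H; now apply Hr, RtoC_inj. Qed.

Lemma Cinv_neq_0 (u : C) : u <> 0%C -> (/ u)%C <> 0%C.
Proof.
  intros Hu H; apply (RtoC_neq_0 1 R1_neq_R0).
  now rewrite <- (Cinv_r u Hu), H, Cmult_0_r.
Qed.

(** Turns complex limits into real ones, so that the squeeze lemmas for real sequences apply. *)
Lemma filterlim_C_Cmod (a : nat -> C) (l : C) :
  filterlim a eventually (locally l) <->
  is_lim_seq (fun n => Cmod (a n - l)%C) 0.
Proof.
  rewrite (filterlim_locally_ball_norm (U := C_NormedModule)).
  rewrite <- is_lim_seq_spec; split.
  - intros H eps; destruct (H eps) as [N HN]; exists N; intros n Hn.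
    rewrite Rminus_0_r, Rabs_pos_eq by apply Cmod_ge_0; exact (HN n Hn).
  - intros H eps; destruct (H eps) as [N HN]; exists N; intros n Hn.
    specialize (HN n Hn).
    rewrite Rminus_0_r, Rabs_pos_eq in HN by apply Cmod_ge_0; exact HN.
Qed.

Lemma is_series_C_unique (a : nat -> C) (s t : C) :
  is_series a s -> is_series a t -> s = t.
Proof.
  intros Hs Ht; now rewrite <- (CSeries_correct a s Hs), (CSeries_correct a t Ht).
Qed.

Lemma ex_series_CSeries (a : nat -> C) :
  ex_series a -> is_series a (CSeries a).
Proof. intros [s Hs]; now rewrite (CSeries_correct a s Hs). Qed.

Lemma CSeries_ext (a b : nat -> C) :
  (forall n, a n = b n) -> CSeries a = CSeries b.
Proof.
  intros H; unfold CSeries; f_equal; apply Series_ext; intros n; now rewrite H.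
Qed.

Lemma ex_series_Cmod (a : nat -> C) :
  ex_series (fun n => Cmod (a n)) -> ex_series a.
Proof.
  intros H; apply (ex_series_le (V := C_CompleteNormedModule) a (fun n => Cmod (a n)));
    [intros n; apply Rle_refl | exact H].
Qed.

Lemma CSeries_scal (c : C) (a : nat -> C) :
  ex_series a -> CSeries (fun n => (c * a n)%C) = (c * CSeries a)%C.
Proof.
  intros Ha; apply CSeries_correct.
  exact (is_series_scal (V := C_NormedModule) c _ _ (ex_series_CSeries a Ha)).
Qed.

Lemma is_series_Cmod_le (a : nat -> C) (s : C) (b : nat -> R) :
  is_series a s -> (forall n, Cmod (a n) <= b n) -> ex_series b ->
  Cmod s <= Series b.
Proof.
  intros Hs Hab Hb.
  assert (H1 : is_lim_seq (fun n => Cmod (sum_n a n)) (Cmod s)).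
  { apply (filterlim_comp _ _ _ _ Cmod _ _ _ Hs).
    exact (filterlim_norm (V := C_NormedModule) s). }
  assert (H2 : is_lim_seq (sum_n b) (Series b)) by apply (Series_correct b Hb).
  refine (is_lim_seq_le _ _ (Cmod s) (Series b) _ H1 H2).
  intros n; induction n as [|n IH]; [rewrite !sum_O; apply Hab|].
  rewrite !sum_Sn; eapply Rle_trans; [apply Cmod_triangle|].
  now apply Rplus_le_compat.
Qed.

Lemma is_series_telescope (e : nat -> C) :
  is_lim_seq (fun n => Cmod (e n)) 0 ->
  is_series (fun n => (e n - e (S n))%C) (e 0%nat).
Proof.
  intros He; apply filterlim_C_Cmod.
  (* The partial sum up to [n] is [e 0 - e (S n)], so its distance to the limit is
     [Cmod (e (S n))]. *)
  apply is_lim_seq_ext with (fun n => Cmod (e (S n)));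
    [|now apply (is_lim_seq_incr_1 (fun n => Cmod (e n)))].
  intros n.
  assert (H : sum_n (fun n => (e n - e (S n))%C) n = (e 0%nat - e (S n))%C).
  { induction n as [|n IH]; [now rewrite sum_O|].
    rewrite sum_Sn, IH; C_ring. }
  change (Cmod (e (S n)) = Cmod (sum_n (fun n => (e n - e (S n))%C) n - e 0%nat)%C).
  rewrite H, <- Cmod_opp; f_equal; ring.
Qed.

(** * Tails of absolutely convergent series *)

Definition Ctail (a : nat -> C) (n : nat) : C := CSeries (fun k => a (n + k)%nat).

Definition Cmod_tail (a : nat -> C) (n : nat) : R :=
  Series (fun k => Cmod (a (n + k)%nat)).

Section Tails.

Variable a : nat -> C.
Hypothesis Ha : ex_series (fun n => Cmod (a n)).

Lemma ex_series_Cmod_shift (n : nat) : ex_series (fun k => Cmod (a (n + k)%nat)).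
Proof. exact (proj1 (ex_series_incr_n (fun n => Cmod (a n)) n) Ha). Qed.

Lemma is_series_Ctail (n : nat) : is_series (fun k => a (n + k)%nat) (Ctail a n).
Proof. apply ex_series_CSeries, ex_series_Cmod, ex_series_Cmod_shift. Qed.

Lemma Ctail_step (n : nat) : Ctail a n = (a n + Ctail a (S n))%C.
Proof.
  apply is_series_C_unique with (1 := is_series_Ctail n).
  apply is_series_decr_1.
  replace (plus _ _) with (Ctail a (S n)).
  - apply is_series_ext with (2 := is_series_Ctail (S n)).
    intros k; f_equal; lia.
  - rewrite Nat.add_0_r; change (Ctail a (S n) = (a n + Ctail a (S n) + - a n)%C); ring.
Qed.

Lemma Cmod_Ctail_le (n : nat) : Cmod (Ctail a n) <= Cmod_tail a n.
Proof.
  apply is_series_Cmod_le with (1 := is_series_Ctail n);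
    [intros k; apply Rle_refl | apply ex_series_Cmod_shift].
Qed.

Lemma Cmod_tail_step (n : nat) : Cmod_tail a n = Cmod (a n) + Cmod_tail a (S n).
Proof.
  unfold Cmod_tail; rewrite Series_incr_1 by apply ex_series_Cmod_shift.
  rewrite Nat.add_0_r; f_equal; apply Series_ext; intros k; do 2 f_equal; lia.
Qed.

(** Each step drops a nonnegative term. For fixed [k] this gives one bound for all later tails, as
    the product estimates require. *)
Lemma Cmod_tail_antitone (n k : nat) : Cmod_tail a (n + k) <= Cmod_tail a k.
Proof.
  induction n as [|n IH]; [apply Rle_refl|].
  refine (Rle_trans _ _ _ _ IH).
  rewrite (Cmod_tail_step (n + k)); pose proof (Cmod_ge_0 (a (n + k)%nat)); simpl; lra.
Qed.

Lemma is_lim_seq_Cmod_tail : is_lim_seq (Cmod_tail a) 0.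
Proof.
  (* [sum_n] up to [n] includes the term [n], so the total minus it is the tail at [n + 1]; hence
     the shift. *)
  apply is_lim_seq_incr_1.
  apply is_lim_seq_ext with
    (fun n => Cmod_tail a 0 - sum_n (fun n => Cmod (a n)) n).
  - induction n as [|n IH].
    + rewrite sum_O, Cmod_tail_step; ring.
    + rewrite sum_Sn.
      rewrite (Cmod_tail_step (S n)) in IH; change plus with Rplus; lra.
  - replace (Finite 0) with (Finite (Cmod_tail a 0 - Cmod_tail a 0)) by (f_equal; ring).
    apply is_lim_seq_minus'; [apply is_lim_seq_const|].
    apply (Series_correct (fun n => Cmod (a n)) Ha).
Qed.

End Tails.

(** * Products of two series, summed along diagonals *)

Lemma ex_series_Cmod_mult_bounded (a b : nat -> C) (M : R) :
  (forall n, Cmod (a n) <= M) -> ex_series (fun n => Cmod (b n)) ->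
  ex_series (fun n => Cmod (a n * b n)%C).
Proof.
  intros HM Hb.
  apply (ex_series_le (V := R_CompleteNormedModule) _ (fun n => M * Cmod (b n))).
  - intros n; change (Rabs (Cmod (a n * b n)%C) <= M * Cmod (b n)).
    rewrite Rabs_pos_eq, Cmod_mult by apply Cmod_ge_0.
    apply Rmult_le_compat_r; [apply Cmod_ge_0 | apply HM].
  - exact (ex_series_scal (V := R_NormedModule) M _ Hb).
Qed.

Lemma ex_series_Cmod_mult_shift (a b : nat -> C) (p r : nat) :
  ex_series (fun n => Cmod (a n)) -> ex_series (fun n => Cmod (b n)) ->
  ex_series (fun n => (a (n + p)%nat * b (n + r)%nat)%C).
Proof.
  intros Ha Hb; apply ex_series_Cmod.
  apply (ex_series_Cmod_mult_bounded (fun n => a (n + p)%nat) (fun n => b (n + r)%nat)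
    (Cmod_tail a 0)).
  - intros n.
    (* A term is at most the absolute tail that starts with it, because the remaining tail dominates
       a modulus and so is nonnegative. *)
    pose proof (Cmod_tail_step a Ha (n + p)) as H1.
    pose proof (Cmod_tail_antitone a Ha (n + p) 0) as H2; rewrite Nat.add_0_r in H2.
    pose proof (Cmod_Ctail_le a Ha (S (n + p))) as H3.
    pose proof (Cmod_ge_0 (Ctail a (S (n + p)))); lra.
  - apply ex_series_ext with (2 := ex_series_Cmod_shift b Hb r).
    intros n; do 2 f_equal; lia.
Qed.

(** Put [e_l = sum_n A_(n+l) b_n] with [A] the tails of [a]. Since [A_(n+l) - A_(n+l+1) = a_(n+l)],
    the diagonal [l] equals [e_l - e_(l+1)]. The sum telescopes to [e_0], because [e_l] is bounded
    by the absolute tail of [a] at [l] times the sum of the [|b_n|]. *)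
Lemma is_series_diagonals (a b : nat -> C) :
  ex_series (fun n => Cmod (a n)) -> ex_series (fun n => Cmod (b n)) ->
  is_series (fun l => CSeries (fun n => (a (n + l)%nat * b n)%C))
    (CSeries (fun n => (Ctail a n * b n)%C)).
Proof.
  intros Ha Hb.
  assert (Hbd : forall l n, Cmod (Ctail a (n + l)) <= Cmod_tail a l).
  { intros l n; eapply Rle_trans; [now apply Cmod_Ctail_le | now apply Cmod_tail_antitone]. }
  set (e := fun l => CSeries (fun n => (Ctail a (n + l) * b n)%C)).
  assert (He : forall l, is_series (fun n => (Ctail a (n + l) * b n)%C) (e l)).
  { intros l; apply ex_series_CSeries, ex_series_Cmod.
    now apply (ex_series_Cmod_mult_bounded (fun n => Ctail a (n + l)) b (Cmod_tail a l)). }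
  replace (CSeries (fun n => (Ctail a n * b n)%C)) with (e 0%nat)
    by (apply CSeries_ext; intros n; now rewrite Nat.add_0_r).
  apply is_series_ext with (fun l => (e l - e (S l))%C).
  - intros l; symmetry; apply CSeries_correct.
    apply is_series_ext with (2 := is_series_minus _ _ _ _ (He l) (He (S l))).
    intros n; rewrite (Ctail_step a Ha (n + l)), Nat.add_succ_r.
    C_ring.
  - apply is_series_telescope.
    apply is_lim_seq_le_le with (fun _ => 0)
      (fun l => Cmod_tail a l * Series (fun n => Cmod (b n))).
    + intros l; split; [apply Cmod_ge_0|].
      rewrite <- Series_scal_l.
      apply is_series_Cmod_le with (1 := He l).
      * intros n; rewrite Cmod_mult.
        apply Rmult_le_compat_r; [apply Cmod_ge_0 | apply Hbd].
      * exact (ex_series_scal (V := R_NormedModule) _ _ Hb).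
    + apply is_lim_seq_const.
    + replace (Finite 0) with (Finite (0 * Series (fun n => Cmod (b n))))
        by (f_equal; ring).
      apply is_lim_seq_mult'; [now apply is_lim_seq_Cmod_tail | apply is_lim_seq_const].
Qed.

Lemma is_bilateral_series_ext (a b : Z -> C) (s : C) :
  (forall l, a l = b l) -> is_bilateral_series a s -> is_bilateral_series b s.
Proof.
  intros H (s1 & s2 & H1 & H2 & Hs); exists s1, s2; split; [|split; [|exact Hs]].
  - apply is_series_ext with (2 := H1); intros n; apply H.
  - apply is_series_ext with (2 := H2); intros n; apply H.
Qed.

(** At most one of [Z.to_nat l] and [Z.to_nat (- l)] is nonzero, so one formula describes the
    diagonals on both sides. *)
Lemma is_bilateral_series_mult (a b : nat -> C) :
  ex_series (fun n => Cmod (a n)) -> ex_series (fun n => Cmod (b n)) ->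
  is_bilateral_series
    (fun l => CSeries (fun n =>
       (a (n + Z.to_nat l)%nat * b (n + Z.to_nat (- l))%nat)%C))
    (CSeries a * CSeries b)%C.
Proof.
  intros Ha Hb.
  assert (Hb1 : ex_series (fun n => Cmod (b (S n))))
    by exact (proj1 (ex_series_incr_1 (fun n => Cmod (b n))) Hb).
  exists (CSeries (fun n => (Ctail a n * b n)%C)),
    (CSeries (fun n => (Ctail (fun k => b (S k)) n * a n)%C)).
  split; [|split].
  - apply is_series_ext with (2 := is_series_diagonals a b Ha Hb).
    intros l; apply CSeries_ext; intros n; do 2 f_equal; lia.
  (* At the index [- S l] the shift falls on [b]. Dropping [b 0] and exchanging the two sequences
     makes it the diagonal [l] of the previous lemma. *)
  - apply is_series_ext with (2 := is_series_diagonals _ a Hb1 Ha).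
    intros l; apply CSeries_ext; intros n; rewrite Cmult_comm; do 2 f_equal; lia.
  - assert (He : is_series
        (fun n => (Ctail a n * Ctail b n - Ctail a (S n) * Ctail b (S n))%C)
        (CSeries a * CSeries b)%C).
    { apply (is_series_telescope (fun n => (Ctail a n * Ctail b n)%C)).
      apply is_lim_seq_le_le with (fun _ => 0) (fun n => Cmod_tail a n * Cmod_tail b n).
      - intros n; split; [apply Cmod_ge_0|].
        rewrite Cmod_mult; apply Rmult_le_compat; try apply Cmod_ge_0;
          now apply Cmod_Ctail_le.
      - apply is_lim_seq_const.
      - replace (Finite 0) with (Finite (0 * 0)) by (f_equal; ring).
        apply is_lim_seq_mult'; now apply is_lim_seq_Cmod_tail. }
    apply is_series_C_unique with (1 := He).
    assert (Hex : forall a b : nat -> C, ex_series (fun n => Cmod (a n)) ->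
        ex_series (fun n => Cmod (b n)) ->
        is_series (fun n => (Ctail a n * b n)%C) (CSeries (fun n => (Ctail a n * b n)%C))).
    { intros a' b' Ha' Hb'; apply ex_series_CSeries, ex_series_Cmod.
      apply ex_series_Cmod_mult_bounded with (2 := Hb') (M := Cmod_tail a' 0).
      intros n; eapply Rle_trans; [now apply Cmod_Ctail_le|].
      rewrite <- (Nat.add_0_r n) at 1; now apply Cmod_tail_antitone. }
    apply is_series_ext with
      (2 := is_series_plus _ _ _ _ (Hex a b Ha Hb) (Hex _ a Hb1 Ha)).
    intros n.
    (* Holds by computation, since [S n + k] reduces to [S (n + k)]. *)
    change (Ctail (fun k => b (S k)) n) with (Ctail b (S n)).
    rewrite (Ctail_step a Ha n), (Ctail_step b Hb n); C_ring.
Qed.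

(** * The q-exponentials as power series *)

Lemma Cmod_RtoC_mult_pow (c : R) (u : C) (n : nat) :
  0 <= c -> Cmod (RtoC c * u ^ n)%C = c * Cmod u ^ n.
Proof. intros H; now rewrite Cmod_mult, Cmod_pow, Cmod_R, Rabs_pos_eq. Qed.

Lemma Rpower_pow_mult (q x : R) (n : nat) : Rpower q x ^ n = Rpower q (x * INR n).
Proof. now rewrite <- Rpower_pow, Rpower_mult by apply exp_pos. Qed.

(** A real copy of [qpoch], so that signs and inequalities can be used. *)
Fixpoint qpochR (a q : R) (n : nat) : R :=
  match n with
  | O => 1
  | S m => qpochR a q m * (1 - a * q ^ m)
  end.

Lemma qpoch_RtoC (a q : R) (n : nat) : qpoch (RtoC a) q n = RtoC (qpochR a q n).
Proof.
  induction n as [|n IH]; [reflexivity|]; simpl.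
  now rewrite IH, RtoC_mult, RtoC_minus, RtoC_mult, RtoC_pow.
Qed.

Lemma qpochR_add (a q : R) (m n : nat) :
  qpochR a q (m + n) = qpochR a q m * qpochR (a * q ^ m) q n.
Proof.
  induction n as [|n IH]; [rewrite Nat.add_0_r; simpl; ring|].
  rewrite Nat.add_succ_r; simpl; rewrite IH, pow_add; ring.
Qed.

Section QExponentials.

Variable q : R.
Hypothesis Hq : 0 < q < 1.

Lemma pow_q_bounds (n : nat) : 0 < q ^ n <= 1.
Proof.
  split; [apply pow_lt; lra|].
  rewrite <- (pow1 n); apply pow_incr; lra.
Qed.

Lemma pow_q_lt_1 (n : nat) : q ^ S n < 1.
Proof. simpl; pose proof (pow_q_bounds n); nra. Qed.

Lemma qpochR_pos (a : R) (n : nat) : 0 <= a < 1 -> 0 < qpochR a q n.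
Proof.
  intros Ha; induction n as [|n IH]; simpl; [lra|].
  apply Rmult_lt_0_compat; [exact IH|]; pose proof (pow_q_bounds n); nra.
Qed.

Lemma is_lim_seq_pow_q : is_lim_seq (fun n => q ^ n) 0.
Proof. apply is_lim_seq_geom; rewrite Rabs_pos_eq; lra. Qed.

Lemma Rpower_q_lt_1 (x : R) : 0 < x -> Rpower q x < 1.
Proof.
  intros Hx; rewrite <- exp_0; unfold Rpower; apply exp_increasing.
  assert (ln q < 0) by (rewrite <- ln_1; apply ln_increasing; lra).
  nra.
Qed.

Lemma Rpower_q_le_1 (x : R) : 0 <= x -> Rpower q x <= 1.
Proof.
  intros [Hx|<-]; [now apply Rlt_le, Rpower_q_lt_1 | rewrite Rpower_O; lra].
Qed.

Section Coefficients.

Variable j : kind.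

Definition kappa : R := (2 - delta j) / 4.

Definition qexp_coef (n : nat) : R :=
  Rpower q (kappa * (INR n * (INR n - 1))) / qpochR q q n.

Lemma kappa_ge_0 : 0 <= kappa.
Proof. unfold kappa; destruct j; simpl; lra. Qed.

Lemma qexp_coef_pos (n : nat) : 0 < qexp_coef n.
Proof. apply Rdiv_lt_0_compat; [apply exp_pos | apply qpochR_pos; lra]. Qed.

Lemma qexp_coef_0 : qexp_coef 0 = 1.
Proof.
  unfold qexp_coef; simpl.
  replace (kappa * _) with 0 by ring; rewrite Rpower_O by lra; field.
Qed.

(** The exponents [kappa n (n - 1)] increase by [2 kappa n]. This recurrence drives both the ratio
    test and the functional equation. *)
Lemma qexp_coef_succ (n : nat) :
  qexp_coef (S n) * (1 - q ^ S n) = qexp_coef n * Rpower q (2 * kappa) ^ n.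
Proof.
  unfold qexp_coef; rewrite S_INR, Rpower_pow_mult.
  replace (kappa * ((INR n + 1) * (INR n + 1 - 1)))
    with (kappa * (INR n * (INR n - 1)) + 2 * kappa * INR n) by ring.
  rewrite Rpower_plus.
  pose proof (pow_q_lt_1 n) as H1.
  pose proof (qpochR_pos q n ltac:(lra)) as H2.
  simpl in *; field; split; nra.
Qed.

Lemma ex_series_qexp_coef (u : C) :
  u <> 0%C -> (j = kind1 -> Cmod u < 1) ->
  ex_series (fun n => Cmod (RtoC (qexp_coef n) * u ^ n)%C).
Proof.
  intros Hu0 Hu.
  assert (Hu0' : 0 < Cmod u) by now apply Cmod_gt_0.
  assert (Hpos : forall n, 0 < qexp_coef n * Cmod u ^ n)
    by (intros n; apply Rmult_lt_0_compat; [apply qexp_coef_pos | now apply pow_lt]).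
  apply ex_series_ext with (fun n => Rabs (qexp_coef n * Cmod u ^ n)).
  { intros n; rewrite Cmod_RtoC_mult_pow by apply Rlt_le, qexp_coef_pos.
    apply Rabs_pos_eq, Rlt_le, Hpos. }
  (* The ratio of consecutive terms tends to [r |u|]. For [kappa = 0], that is [kind1], [r = 1] and
     [|u| < 1] is used; otherwise [r = 0]. *)
  assert (Hlim : exists r, r * Cmod u < 1 /\
            is_lim_seq (fun n => Rpower q (2 * kappa) ^ n) r).
  { destruct (Req_dec kappa 0) as [Hk|Hk].
    - exists 1; split.
      + rewrite Rmult_1_l; apply Hu; unfold kappa in Hk; destruct j;
          try reflexivity; exfalso; simpl in Hk; lra.
      + apply is_lim_seq_ext with (fun _ => 1); [|apply is_lim_seq_const].
        intros n; rewrite Hk, Rmult_0_r, Rpower_O, pow1 by lra; reflexivity.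
    - exists 0; split; [lra|].
      apply is_lim_seq_geom.
      rewrite Rabs_pos_eq by apply Rlt_le, exp_pos.
      apply Rpower_q_lt_1; pose proof kappa_ge_0; lra. }
  destruct Hlim as (r & Hr & Hlim).
  apply ex_series_DAlembert with (r * Cmod u); [exact Hr| |].
  { intros n; apply Rgt_not_eq, Hpos. }
  apply is_lim_seq_ext with
    (fun n => Rpower q (2 * kappa) ^ n / (1 - q ^ S n) * Cmod u).
  - intros n.
    pose proof (pow_q_lt_1 n) as H1.
    rewrite Rabs_pos_eq by (apply Rlt_le, Rdiv_lt_0_compat; apply Hpos).
    replace (qexp_coef (S n))
      with (qexp_coef n * Rpower q (2 * kappa) ^ n / (1 - q ^ S n))
      by (rewrite <- qexp_coef_succ; field; lra).
    pose proof (qexp_coef_pos n).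
    pose proof (pow_lt _ n Hu0').
    change (Cmod u ^ S n) with (Cmod u * Cmod u ^ n).
    field; lra.
  - apply is_lim_seq_mult'; [|apply is_lim_seq_const].
    replace r with (r / (1 - 0)) by field.
    apply is_lim_seq_div'; [exact Hlim| |lra].
    apply is_lim_seq_minus'; [apply is_lim_seq_const|].
    exact (proj1 (is_lim_seq_incr_1 (fun n => q ^ n) 0) is_lim_seq_pow_q).
Qed.

(** * Functional equation of the sums and their limit at the origin *)

Definition qexp_sum (u : C) : C := CSeries (fun n => (RtoC (qexp_coef n) * u ^ n)%C).

Section Disk.

Variable u : C.
Hypothesis Hu0 : u <> 0%C.
Hypothesis Hu : j = kind1 -> Cmod u < 1.

Lemma shrink_neq_0 (r : R) : 0 < r -> (RtoC r * u)%C <> 0%C.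
Proof.
  intros Hr; apply Cmult_neq_0; [|exact Hu0].
  apply RtoC_neq_0; lra.
Qed.

Lemma shrink_Cmod (r : R) : 0 < r <= 1 -> j = kind1 -> Cmod (RtoC r * u)%C < 1.
Proof.
  intros Hr Hj; rewrite Cmod_mult, Cmod_R, Rabs_pos_eq by lra.
  pose proof (Hu Hj); pose proof (Cmod_ge_0 u); nra.
Qed.

(** The factor [r] lets one hypothesis on [u] serve the points [u], [q u], [q^(2 kappa) u] and
    [q^n u]. *)
Lemma is_series_qexp_sum (r : R) :
  0 < r <= 1 ->
  is_series (fun n => (RtoC (qexp_coef n) * (RtoC r * u) ^ n)%C) (qexp_sum (RtoC r * u)%C).
Proof.
  intros Hr; apply ex_series_CSeries, ex_series_Cmod, ex_series_qexp_coef;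
    [apply shrink_neq_0; lra | now apply shrink_Cmod].
Qed.

Lemma qexp_sum_diff :
  (qexp_sum u - qexp_sum (RtoC q * u) = u * qexp_sum (RtoC (Rpower q (2 * kappa)) * u))%C.
Proof.
  assert (Hk : 0 < Rpower q (2 * kappa) <= 1).
  { split; [apply exp_pos|]; apply Rpower_q_le_1; pose proof kappa_ge_0; lra. }
  pose proof (is_series_qexp_sum 1 ltac:(lra)) as H1.
  pose proof (is_series_qexp_sum q ltac:(lra)) as H2.
  pose proof (is_series_qexp_sum _ Hk) as H3.
  rewrite Cmult_1_l in H1.
  apply (is_series_scal (V := C_NormedModule) u) in H3.
  apply is_series_C_unique with (1 := is_series_minus _ _ _ _ H1 H2).
  (* The constant terms cancel; the coefficients of [u^(n+1)] then agree by [qexp_coef_succ]. *)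
  apply is_series_decr_1.
  match goal with |- is_series _ ?s => replace s with (u * qexp_sum (RtoC (Rpower q (2 * kappa)) * u))%C end.
  - apply is_series_ext with (2 := H3); intros n.
    change scal with Cmult; rewrite !Cpow_mult_l.
    transitivity (RtoC (qexp_coef (S n) * (1 - q ^ S n)) * u ^ S n)%C.
    + rewrite qexp_coef_succ, RtoC_mult, RtoC_pow; simpl; C_ring.
    + rewrite RtoC_mult, RtoC_minus, RtoC_pow; C_ring.
  - simpl; C_ring.
Qed.

(** The constant term is 1. As [(q^n)^(k+1) <= q^n], the remaining terms at [q^n u] are at most
    [q^n] times those at [u] in modulus. *)
Lemma qexp_sum_shrink_lim :
  filterlim (fun n => qexp_sum (RtoC (q ^ n) * u)%C) eventually (locally (RtoC 1)).
Proof.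
  apply filterlim_C_Cmod.
  set (M := Series (fun k => Cmod (RtoC (qexp_coef (S k)) * u ^ S k)%C)).
  assert (HM : ex_series (fun k => Cmod (RtoC (qexp_coef (S k)) * u ^ S k)%C)).
  { exact (proj1 (ex_series_incr_1 (fun k => Cmod (RtoC (qexp_coef k) * u ^ k)%C))
      (ex_series_qexp_coef u Hu0 Hu)). }
  apply is_lim_seq_le_le with (fun _ => 0) (fun n => q ^ n * M).
  - intros n; split; [apply Cmod_ge_0|].
    pose proof (pow_q_bounds n) as Hn.
    pose proof (is_series_qexp_sum (q ^ n) Hn) as H.
    unfold M; rewrite <- Series_scal_l.
    apply is_series_Cmod_le with
      (fun k => (RtoC (qexp_coef (S k)) * (RtoC (q ^ n) * u) ^ S k)%C).
    + apply (is_series_incr_1 (V := C_NormedModule)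
        (fun k => (RtoC (qexp_coef k) * (RtoC (q ^ n) * u) ^ k)%C)).
      rewrite qexp_coef_0.
      match goal with |- is_series _ ?s => replace s with (qexp_sum (RtoC (q ^ n) * u)%C) end;
        [exact H | simpl; C_ring].
    + intros k; rewrite !Cmod_RtoC_mult_pow by apply Rlt_le, qexp_coef_pos.
      rewrite Cmod_mult, Cmod_R, Rabs_pos_eq, Rpow_mult_distr by lra.
      pose proof (qexp_coef_pos (S k)).
      assert (0 <= Cmod u ^ S k) by apply pow_le, Cmod_ge_0.
      assert ((q ^ n) ^ S k <= q ^ n).
      { simpl; rewrite <- (Rmult_1_r (q ^ n)) at 3.
        apply Rmult_le_compat_l; [lra|]; rewrite <- (pow1 k); apply pow_incr; lra. }
      replace (q ^ n * (qexp_coef (S k) * Cmod u ^ S k))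
        with (qexp_coef (S k) * (q ^ n * Cmod u ^ S k)) by ring.
      apply Rmult_le_compat_l; [lra|]; now apply Rmult_le_compat_r.
    + exact (ex_series_scal (V := R_NormedModule) _ _ HM).
  - apply is_lim_seq_const.
  - replace (Finite 0) with (Finite (0 * M)) by (f_equal; ring).
    apply is_lim_seq_mult'; [apply is_lim_seq_pow_q | apply is_lim_seq_const].
Qed.

End Disk.

End Coefficients.

(** * Euler's product formulas *)

Lemma qpoch_qexp_sum1 (u : C) (n : nat) :
  u <> 0%C -> Cmod u < 1 ->
  (qpoch u q n * qexp_sum kind1 u = qexp_sum kind1 (RtoC (q ^ n) * u))%C.
Proof.
  intros Hu0 Hu; induction n as [|n IH]; [simpl; rewrite !Cmult_1_l; reflexivity|].
  pose proof (qexp_sum_diff kind1 (RtoC (q ^ n) * u)%C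
    (shrink_neq_0 u Hu0 _ (proj1 (pow_q_bounds n)))
    (shrink_Cmod kind1 u (fun _ => Hu) _ (pow_q_bounds n))) as H.
  (* The functional equation becomes [f(q v) = (1 - v) f(v)] at [v = q^n u], which supplies the next
     factor. *)
  replace (2 * kappa kind1) with 0 in H by (unfold kappa; simpl; field).
  rewrite Rpower_O, Cmult_1_l in H by lra.
  replace (RtoC (q ^ S n) * u)%C with (RtoC q * (RtoC (q ^ n) * u))%C
    by (simpl; rewrite RtoC_mult; ring).
  transitivity ((1 - RtoC (q ^ n) * u) * (qpoch u q n * qexp_sum kind1 u))%C.
  - simpl; rewrite RtoC_pow; ring.
  - rewrite IH.
    replace (qexp_sum kind1 (RtoC q * (RtoC (q ^ n) * u))) with
      (qexp_sum kind1 (RtoC (q ^ n) * u)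
       - (qexp_sum kind1 (RtoC (q ^ n) * u) - qexp_sum kind1 (RtoC q * (RtoC (q ^ n) * u))))%C
      by ring.
    rewrite H; ring.
Qed.

Lemma qpoch_qexp_sum2 (u : C) (n : nat) :
  u <> 0%C ->
  (qexp_sum kind2 u = qpoch (- u) q n * qexp_sum kind2 (RtoC (q ^ n) * u))%C.
Proof.
  intros Hu0; induction n as [|n IH]; [simpl; rewrite !Cmult_1_l; reflexivity|].
  pose proof (qexp_sum_diff kind2 (RtoC (q ^ n) * u)%C
    (shrink_neq_0 u Hu0 _ (proj1 (pow_q_bounds n))) ltac:(discriminate)) as H.
  (* Here it becomes [f(v) = (1 + v) f(q v)]. *)
  replace (2 * kappa kind2) with 1 in H by (unfold kappa; simpl; field).
  rewrite Rpower_1 in H by lra.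
  replace (RtoC (q ^ S n) * u)%C with (RtoC q * (RtoC (q ^ n) * u))%C
    by (simpl; rewrite RtoC_mult; ring).
  rewrite IH.
  replace (qexp_sum kind2 (RtoC (q ^ n) * u)) with
      ((qexp_sum kind2 (RtoC (q ^ n) * u)
       - qexp_sum kind2 (RtoC q * (RtoC (q ^ n) * u))) + qexp_sum kind2 (RtoC q * (RtoC (q ^ n) * u)))%C
      by ring.
  rewrite H; simpl; rewrite RtoC_pow; ring.
Qed.

(** A zero at [u] would force zeros at all [q^n u], against the limit 1. *)
Lemma qexp_sum1_neq_0 (u : C) :
  u <> 0%C -> Cmod u < 1 -> qexp_sum kind1 u <> 0%C.
Proof.
  intros Hu0 Hu H.
  pose proof (proj1 (filterlim_C_Cmod _ _)
    (qexp_sum_shrink_lim kind1 u Hu0 (fun _ => Hu))) as Hl.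
  apply is_lim_seq_ext with (v := fun _ => 1) in Hl.
  - apply is_lim_seq_unique in Hl; rewrite Lim_seq_const in Hl.
    injection Hl; lra.
  - intros n; rewrite <- qpoch_qexp_sum1 by assumption.
    rewrite H, Cmult_0_r.
    replace (0 - 1)%C with (- (1))%C by ring; apply Cmod_m1.
Qed.

Lemma qpoch_inf_qexp_sum1 (u : C) :
  u <> 0%C -> Cmod u < 1 -> qpoch_inf u q = (/ qexp_sum kind1 u)%C.
Proof.
  intros Hu0 Hu; apply Clim_correct, filterlim_C_Cmod.
  pose proof (qexp_sum1_neq_0 u Hu0 Hu) as Hne.
  pose proof (proj1 (filterlim_C_Cmod _ _)
    (qexp_sum_shrink_lim kind1 u Hu0 (fun _ => Hu))) as Hl.
  apply is_lim_seq_ext with (fun n =>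
    / Cmod (qexp_sum kind1 u) * Cmod (qexp_sum kind1 (RtoC (q ^ n) * u) - 1)%C).
  - intros n; rewrite <- Cmod_inv, <- Cmod_mult by exact Hne; f_equal.
    rewrite <- qpoch_qexp_sum1 by assumption; field; exact Hne.
  - replace (Finite 0) with (Finite (/ Cmod (qexp_sum kind1 u) * 0)) by (f_equal; ring).
    apply is_lim_seq_mult'; [apply is_lim_seq_const | exact Hl].
Qed.

Lemma qpoch_inf_qexp_sum2 (u : C) :
  u <> 0%C -> qpoch_inf (- u) q = qexp_sum kind2 u.
Proof.
  intros Hu0; apply Clim_correct, filterlim_C_Cmod.
  pose proof (proj1 (filterlim_C_Cmod _ _)
    (qexp_sum_shrink_lim kind2 u Hu0 ltac:(discriminate))) as Hl.
  set (f := fun n => qexp_sum kind2 (RtoC (q ^ n) * u)%C) in *.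
  set (F := Cmod (qexp_sum kind2 u)).
  (* Eventually [|f n| >= 1/2], so [F = |qpoch (- u) q n| |f n|] bounds the finite products by
     [2 F]. The error is such a product times [f n - 1], up to sign. *)
  apply is_lim_seq_le_le_loc with (fun _ => 0) (fun n => 2 * F * Cmod (f n - 1)%C).
  - destruct (proj2 (is_lim_seq_spec _ _) Hl (mkposreal (1/2) ltac:(lra))) as [N HN].
    exists N; intros n Hn; specialize (HN n Hn); simpl in HN.
    rewrite Rminus_0_r, Rabs_pos_eq in HN by apply Cmod_ge_0.
    split; [apply Cmod_ge_0|].
    assert (Hf : 1 / 2 <= Cmod (f n)).
    { pose proof (Cmod_triangle (f n) (- (f n - 1))%C) as Ht.
      rewrite Cmod_opp in Ht.
      replace (f n + - (f n - 1))%C with (RtoC 1) in Ht by ring.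
      rewrite Cmod_1 in Ht; lra. }
    pose proof (qpoch_qexp_sum2 u n Hu0) as HF; fold (f n) in HF.
    assert (HF' : F = Cmod (qpoch (- u) q n) * Cmod (f n))
      by (unfold F; rewrite HF at 1; apply Cmod_mult).
    replace (qpoch (- u) q n - qexp_sum kind2 u)%C
      with (- (qpoch (- u) q n * (f n - 1)))%C by (rewrite HF; ring).
    rewrite Cmod_opp, Cmod_mult.
    apply Rmult_le_compat_r; [apply Cmod_ge_0|].
    pose proof (Cmod_ge_0 (qpoch (- u) q n)); nra.
  - apply is_lim_seq_const.
  - replace (Finite 0) with (Finite (2 * F * 0)) by (f_equal; ring).
    apply is_lim_seq_mult'; [apply is_lim_seq_const | exact Hl].
Qed.

Lemma qexp_eq_sum (j : kind) (u : C) :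
  u <> 0%C -> (j = kind1 -> Cmod u < 1) -> qexp j q u = qexp_sum j u.
Proof.
  intros Hu0 Hu; destruct j; simpl.
  - rewrite qpoch_inf_qexp_sum1 by auto.
    pose proof (qexp_sum1_neq_0 u Hu0 (Hu eq_refl)); field; auto.
  - now apply qpoch_inf_qexp_sum2.
  - apply CSeries_ext; intros n; unfold qexp_coef.
    pose proof (qpochR_pos q n ltac:(lra)) as Hn.
    rewrite qpoch_RtoC, RtoC_div by lra.
    replace (kappa kind3 * (INR n * (INR n - 1))) with (INR n * (INR n - 1) / 4)
      by (unfold kappa; simpl; field).
    unfold Cdiv; ring.
Qed.

End QExponentials.

(** * Laurent coefficients *)

Lemma Cpowz_split (u v : C) (l : Z) (n : nat) :
  u <> 0%C ->
  (u ^ (n + Z.to_nat l) * (v / u) ^ (n + Z.to_nat (- l)))%C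
  = (Cpowz u l * v ^ (n + Z.to_nat (- l)))%C.
Proof.
  intros Hu; unfold Cdiv; rewrite Cpow_mult_l, Cpow_inv by exact Hu.
  destruct l as [|p|p]; simpl Z.to_nat; simpl Cpowz; simpl Z.opp;
    rewrite ?Z2Nat.inj_0, !Cpow_add_r; simpl; field;
    repeat split; now apply Cpow_nz.
Qed.

Lemma Z_to_nat_abs (l : Z) :
  (Z.to_nat l + Z.to_nat (- l))%nat = Z.abs_nat l /\ (Z.to_nat l * Z.to_nat (- l))%nat = 0%nat.
Proof. destruct l; simpl; lia. Qed.

Lemma IZR_to_nat (l : Z) : IZR l = INR (Z.to_nat l) - INR (Z.to_nat (- l)).
Proof. rewrite !INR_IZR_INZ, <- minus_IZR; f_equal; lia. Qed.

(** With [p], [r] the positive and negative parts of [l], [p r = 0] and [p + r = m]. The quadratic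
    exponents give [kappa l^2 + 2 kappa n (n + m)]. The linear ones give [- kappa (m + 2 n) + n + r
    = - l / 2 + (delta / 4) (m + 2 n)], which is the source of the Bessel argument
    [2 q^(delta / 4)]. *)
Lemma qexp_coef_mult (q : R) (j : kind) (l : Z) (n : nat) :
  0 < q < 1 ->
  let m := Z.abs_nat l in
  let r := Z.to_nat (- l) in
  qexp_coef q j (n + Z.to_nat l) * qexp_coef q j (n + r) * q ^ (n + r) =
  Rpower q (kappa j * IZR l ^ 2 - IZR l / 2) / qpochR q q m *
  (Rpower q ((2 - delta j) / 2 * (INR n * (INR n + INR m))) *
   Rpower q (delta j / 4) ^ (m + 2 * n) /
   (qpochR q q n * qpochR (q ^ (m + 1)) q n)).
Proof.
  intros Hq m r.
  destruct (Z_to_nat_abs l) as [Hm H0]; fold m r in Hm, H0.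
  assert (Hl := IZR_to_nat l); fold r in Hl.
  set (p := Z.to_nat l) in *.
  assert (Hpoch : qpochR q q (n + p) * qpochR q q (n + r)
    = qpochR q q m * qpochR (q ^ (m + 1)) q n * qpochR q q n).
  (* In this form the first two factors on the right merge into [(q, q)_(m+n)]. *)
  { replace (q ^ (m + 1)) with (q * q ^ m) by (rewrite pow_add; ring).
    rewrite <- qpochR_add; rewrite <- Hm.
    apply Nat.eq_mul_0 in H0; destruct H0 as [->| ->];
      rewrite ?Nat.add_0_r, ?Nat.add_0_l; [rewrite (Nat.add_comm r n) | rewrite (Nat.add_comm p n)];
      ring. }
  assert (H1 := qpochR_pos q Hq q (n + p) ltac:(lra)).
  assert (H2 := qpochR_pos q Hq q (n + r) ltac:(lra)).
  assert (H3 := qpochR_pos q Hq q m ltac:(lra)).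
  assert (H4 := qpochR_pos q Hq q n ltac:(lra)).
  assert (H5 : 0 < qpochR (q ^ (m + 1)) q n).
  { apply qpochR_pos; [exact Hq|]; rewrite Nat.add_1_r; split.
    - apply pow_le; lra.
    - now apply pow_q_lt_1. }
  unfold qexp_coef.
  rewrite Rpower_pow_mult, <- (Rpower_pow (n + r) q) by lra.
  transitivity (Rpower q (kappa j * (INR (n + p) * (INR (n + p) - 1))
      + kappa j * (INR (n + r) * (INR (n + r) - 1)) + INR (n + r))
    / (qpochR q q (n + p) * qpochR q q (n + r))).
  { rewrite !Rpower_plus; field; lra. }
  transitivity (Rpower q (kappa j * IZR l ^ 2 - IZR l / 2
      + (2 - delta j) / 2 * (INR n * (INR n + INR m)) + delta j / 4 * INR (m + 2 * n))
    / (qpochR q q m * qpochR (q ^ (m + 1)) q n * qpochR q q n)).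
  2: { rewrite !Rpower_plus; field; lra. }
  rewrite Hpoch; f_equal; f_equal.
  rewrite Hl, <- Hm; unfold kappa.
  rewrite !plus_INR, mult_INR; simpl (INR 2).
  apply (f_equal INR) in H0; rewrite mult_INR in H0; simpl (INR 0) in H0.
  (* The two exponents differ by a multiple of [p * r], and [p] or [r] is 0. *)
  apply Rminus_diag_uniq.
  transitivity ((2 - delta j) / 2 * (INR p * INR r)); [field | rewrite H0; ring].
Qed.

Lemma qBesselI_Laurent_coef (j : kind) (q : R) (u : C) (l : Z) :
  0 < q < 1 -> u <> 0%C ->
  ex_series (fun n => Cmod (RtoC (qexp_coef q j n) * u ^ n)%C) ->
  ex_series (fun n => Cmod (RtoC (qexp_coef q j n) * (RtoC q / u) ^ n)%C) ->
  CSeries (fun n => (RtoC (qexp_coef q j (n + Z.to_nat l)) * u ^ (n + Z.to_nat l)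
    * (RtoC (qexp_coef q j (n + Z.to_nat (- l))) * (RtoC q / u) ^ (n + Z.to_nat (- l))))%C)
  = (Cpowz u l
     * RtoC (Rpower q ((2 - delta j) / 4 * IZR l ^ 2 - IZR l / 2))
     * qBesselI j q l (RtoC (2 * Rpower q (delta j / 4))))%C.
Proof.
  intros Hq Hu Ha Hb.
  set (k := Rpower q ((2 - delta j) / 4 * IZR l ^ 2 - IZR l / 2)).
  set (m := Z.abs_nat l).
  assert (Hm : 0 < qpochR q q m) by (apply qpochR_pos; lra).
  assert (Hk : 0 < k) by apply exp_pos.
  assert (Hpow : Cpowz u l <> 0%C).
  { destruct l; simpl;
      [apply RtoC_neq_0; lra | now apply Cpow_nz | now apply Cinv_neq_0, Cpow_nz]. }
  assert (HK : (Cpowz u l * RtoC (k / qpochR q q m) <> 0)%C).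
  { apply Cmult_neq_0; [exact Hpow|].
    apply RtoC_neq_0, Rgt_not_eq, Rdiv_lt_0_compat; assumption. }
  unfold qBesselI; fold m.
  (* Each Bessel term is a diagonal term divided by a nonzero constant. The scaling is done on this
     side because convergence is known for the diagonal series. *)
  match goal with |- _ = (_ * (_ * CSeries ?B))%C =>
  rewrite (CSeries_ext B (fun n => (/ (Cpowz u l * RtoC (k / qpochR q q m)) *
    ((RtoC (qexp_coef q j (n + Z.to_nat l)) * u ^ (n + Z.to_nat l))
    * (RtoC (qexp_coef q j (n + Z.to_nat (- l))) * (RtoC q / u) ^ (n + Z.to_nat (- l)))))%C)) end.
  - rewrite CSeries_scal by exact (ex_series_Cmod_mult_shift _ _ _ _ Ha Hb).
    rewrite qpoch_RtoC, RtoC_div by lra.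
    assert (RtoC (qpochR q q m) <> 0%C) by (apply RtoC_neq_0; lra).
    assert (RtoC k <> 0%C) by (apply RtoC_neq_0; lra).
    field; auto.
  - intros n.
    replace (RtoC (2 * Rpower q (delta j / 4)) / 2)%C with (RtoC (Rpower q (delta j / 4)))
      by (rewrite RtoC_mult; field; apply RtoC_neq_0; lra).
    rewrite <- !RtoC_pow, !qpoch_RtoC.
    assert (H5 : 0 < qpochR (q ^ (m + 1)) q n).
    { apply qpochR_pos; [exact Hq|]; rewrite Nat.add_1_r; split.
      - apply pow_le; lra.
      - now apply pow_q_lt_1. }
    assert (H4 : 0 < qpochR q q n) by (apply qpochR_pos; lra).
    rewrite <- !RtoC_mult, <- RtoC_div by nra.
    match goal with |- RtoC ?x = _ => set (y := x) end.
    transitivity (/ (Cpowz u l * RtoC (k / qpochR q q m)) *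
      (RtoC (qexp_coef q j (n + Z.to_nat l)) * RtoC (qexp_coef q j (n + Z.to_nat (- l)))
       * (u ^ (n + Z.to_nat l) * (RtoC q / u) ^ (n + Z.to_nat (- l)))))%C; [|ring].
    rewrite Cpowz_split by exact Hu.
    transitivity (/ (Cpowz u l * RtoC (k / qpochR q q m)) * (Cpowz u l *
       RtoC (qexp_coef q j (n + Z.to_nat l) * qexp_coef q j (n + Z.to_nat (- l))
         * q ^ (n + Z.to_nat (- l)))))%C;
      [|rewrite !RtoC_mult, RtoC_pow; ring].
    rewrite qexp_coef_mult by exact Hq.
    fold m; unfold kappa; fold k; fold y.
    rewrite (RtoC_mult (k / _)).
    assert (RtoC (k / qpochR q q m) <> 0%C) by (intros H; apply HK; rewrite H; ring).
    field; auto.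
Qed.

(** * Laurent expansion of the product *)

Theorem proposition3p1 :
  forall (j : kind) (q theta z : R) (u : C),
    0 < q < 1 ->
    0 < z ->
    u = ((cos theta, sin theta) * RtoC (z * (1 - q ^ 2)))%C ->
    (j = kind1 -> q < Cmod u < 1) ->
    is_bilateral_series
      (fun l : Z =>
         (Cpowz u l
          * RtoC (Rpower q ((2 - delta j) / 4 * IZR l ^ 2 - IZR l / 2))
          * qBesselI j q l (RtoC (2 * Rpower q (delta j / 4))))%C)
      (Lambda j q u).
Proof.
  intros j q theta z u Hq Hz Hu Hj.
  assert (Hu0 : u <> 0%C).
  { rewrite Hu; apply Cmult_neq_0.
    - intros H; injection H; intros Hs Hc.
      pose proof (sin2_cos2 theta) as H1; rewrite Hs, Hc in H1.
      unfold Rsqr in H1; lra.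
    - apply RtoC_neq_0, Rgt_not_eq, Rmult_lt_0_compat; nra. }
  assert (Hq0 : RtoC q <> 0%C) by (apply RtoC_neq_0; lra).
  assert (Hv0 : (RtoC q / u <> 0)%C)
    by (apply Cmult_neq_0; [exact Hq0 | now apply Cinv_neq_0]).
  (* The lower bound [q < |u|] is exactly what makes the series at [q / u] converge for [kind1]. *)
  assert (Hv : j = kind1 -> Cmod (RtoC q / u)%C < 1).
  { intros Hj1; destruct (Hj Hj1) as [H _].
    rewrite Cmod_div, Cmod_R, Rabs_pos_eq by (exact Hu0 || lra).
    apply Rmult_lt_reg_r with (Cmod u); [lra|].
    unfold Rdiv; rewrite Rmult_assoc, Rinv_l; lra. }
  assert (Hu1 : j = kind1 -> Cmod u < 1) by (intros Hj1; now apply Hj).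
  pose proof (ex_series_qexp_coef q Hq j u Hu0 Hu1) as Ha.
  pose proof (ex_series_qexp_coef q Hq j _ Hv0 Hv) as Hb.
  unfold Lambda; rewrite !(qexp_eq_sum q Hq) by assumption.
  refine (is_bilateral_series_ext _ _ _ _ (is_bilateral_series_mult _ _ Ha Hb)).
  intros l; now apply qBesselI_Laurent_coef.
Qed.
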